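(* For every integer $k\ge 1$, the number of plane symplectic wave graphs with vertex set $\{1,2,\dots,2k\}$ equals $$\frac{(2k)!\,(2k+2)!\cdot 6}{k!\,(k+1)!\,(k+2)!\,(k+3)!}.$$
   Context: A plane symplectic wave graph with vertex set $\{1,2,\dots,m\}$ is a simple graph on these vertices satisfying the following conditions. Each connected component is a path of length $\ge 1$ (no isolated vertices). If a component is the path with consecutive vertices $i_1,i_2,\dots,i_{l+1}$, then $i_1<i_2<\dots<i_{l+1}$. The graph can be drawn in the plane, viewed as the upper and lower open half-planes glued along the real line (vertices placed at the points $1,\dots,m$ of $\mathbb{R}$, each edge drawn as an arc inside one half-plane), so that: the first edge $\{i_1i_2\}$ of each component is drawn in the upper half-plane; each subsequent edge $\{i_ji_{j+1}\}$ is drawn in the half-plane opposite to the one containing the preceding edge $\{i_{j-1}i_j\}$; the last edge $\{i_li_{l+1}\}$ of each component is drawn in the upper half-plane; and no two edges intersect except at common endpoints. *)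

(* Defs.v *)
From mathcomp Require Import all_boot all_order all_algebra.
From mathcomp Require Import all_classical all_reals topology normedtype.

Set Implicit Arguments.
Unset Strict Implicit.
Unset Printing Implicit Defensive.

Import Order.TTheory GRing.Theory Num.Theory.
Import numFieldNormedType.Exports.

Local Open Scope ring_scope.

(* A graph on m vertices is given by its set of edges E; the element i of 'I_m
   stands for the vertex i + 1 of {1, ..., m}. *)

Definition simple_graph (m : nat) (E : {set {set 'I_m}}) : Prop :=
  forall e, e \in E -> #|e| = 2%N.

Definition adj (m : nat) (E : {set {set 'I_m}}) : rel 'I_m :=
  fun x y => [set x; y]%SET \in E.

Definition component (m : nat) (E : {set {set 'I_m}}) (x : 'I_m) : {set 'I_m} :=
  [set y | connect (adj E) x y]%SET.

(* [:: {i_1, i_2}; {i_2, i_3}; ...; {i_l, i_(l+1)}] for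
   p = [:: i_1; ...; i_(l+1)] *)
Definition path_edges (m : nat) (p : seq 'I_m) : seq {set 'I_m} :=
  [seq [set u.1; u.2]%SET | u <- zip p (behead p)].

(* p lists the consecutive vertices, in increasing order, of a connected
   component of E that is a path of length >= 1. The last clause says that the
   edges of E inside this component are the path edges and no others. *)
Definition wave_component (m : nat) (E : {set {set 'I_m}}) (p : seq 'I_m) :
    Prop :=
  [/\ (1 < size p)%N,
      sorted (fun i j : 'I_m => (i < j)%N) p,
      forall x, x \in p -> [set y in p]%SET = component E x
    & [set e in E | e \subset [set y in p]%SET]%SET
        = [set e in path_edges p]%SET].

Section Drawing.
Variable R : realType.

Definition vertex_point (m : nat) (i : 'I_m) : R * R := (i.+1%:R, 0).

(* Upper (up = true) or lower (up = false) open half-plane. *)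
Definition half_plane (up : bool) : set (R * R) :=
  [set z | if up then 0 < z.2 else z.2 < 0]%classic.

(* A is a simple arc joining a and b, contained in the given open half-plane
   apart from its endpoints. *)
Definition arc_in_half_plane (up : bool) (a b : R * R) (A : set (R * R)) :
    Prop :=
  exists g : R -> R * R,
    [/\ {within `[0, 1], continuous g}%classic
          /\ set_inj `[0, 1]%classic g,
        g 0 = a,
        g 1 = b,
        (g @` `]0, 1[ `<=` half_plane up)%classic
      & (g @` `[0, 1])%classic = A].

(* up e tells in which half-plane the edge e is drawn, and arc e is the curve
   representing e. *)
Definition symplectic_drawing (m : nat) (E : {set {set 'I_m}})
    (up : {set 'I_m} -> bool) (arc : {set 'I_m} -> set (R * R)) : Prop :=
  [/\ forall p, wave_component E p ->
        let s := map up (path_edges p) in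
        [/\ head false s, sorted (fun a b => a != b) s & last false s],
      forall i j : 'I_m, (i < j)%N -> [set i; j]%SET \in E ->
        arc_in_half_plane (up [set i; j]%SET)
          (vertex_point i) (vertex_point j) (arc [set i; j]%SET)
    & forall e f, e \in E -> f \in E -> e != f ->
        (arc e `&` arc f `<=`
           [set vertex_point v | v in [set v | v \in e /\ v \in f]])%classic].

Definition plane_symplectic_wave_graph (m : nat) (E : {set {set 'I_m}}) :
    Prop :=
  [/\ simple_graph E,
      forall v, exists2 p, v \in p & wave_component E p
    & exists up arc, symplectic_drawing E up arc].

Definition plane_symplectic_wave_graphs (m : nat) : {set {set {set 'I_m}}} :=
  [set E | `[< plane_symplectic_wave_graph E >]]%SET.

End Drawing.

(* Main.v *)
(* Read a wave graph from left to right and record, at each vertex, whether it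
   opens or closes an arc in each half-plane. The first vertex of a component
   opens an upper arc, the last one closes an upper arc, and an inner vertex
   closes an arc on one side and opens one on the other. The numbers (a, b) of
   open upper and lower arcs thus perform a Gouyou-Beauchamps excursion in the
   quarter plane, with steps (1,0), (-1,0), (-1,1), (1,-1). Since arcs in the same
   half-plane do not cross, the arcs are recovered from the excursion as the
   noncrossing matching of ascents with descents, and any excursion arises (draw
   parabolas). The excursions are pairs (a, a + 2 b) of noncrossing Dyck paths,
   counted by a 2 x 2 determinant of ballot numbers.

   That disjoint arcs in a half-plane have non-interleaved endpoints is proved
   with a parity argument in the style of Sperner's lemma. *)
Require Import Defs.
From mathcomp Require Import all_boot all_order all_algebra.
From mathcomp Require Import all_classical all_reals topology normedtype.
From mathcomp Require Import zify ring lra.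

Set Implicit Arguments.
Unset Strict Implicit.
Unset Printing Implicit Defensive.

Import Order.TTheory GRing.Theory Num.Theory.
Import numFieldNormedType.Exports.

Local Open Scope ring_scope.

(** * Crossing arcs in a half-plane *)

(** The Lebesgue number argument with a hereditary property [Q] in place of an open cover:
    near-covering compactness, along small positive radii, makes the local radii uniform. *)
Lemma lebesgue_number (R : realType) (X : pseudoMetricType R) (K : set X)
    (Q : set X -> Prop) :
  compact K -> (forall A B : set X, (A `<=` B)%classic -> Q B -> Q A) ->
  (forall x, K x -> exists2 e : R, 0 < e & Q (K `&` ball x e)%classic) ->
  exists2 e : R, 0 < e & forall x, K x -> Q (K `&` ball x e)%classic.
Proof.
move=> /compact_near_coveringP cK Qsub Qloc.
have : \forall e \near (0^'+)%classic, (K `<=` fun x => Q (K `&` ball x e))%classic.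
  apply: cK => x Kx; have [r r0 Qr] := Qloc x Kx.
  have r20 : 0 < r / 2 by rewrite divr_gt0.
  exists (ball x (r / 2), [set e | e < r / 2])%classic => /=.
    split; first exact: nbhsx_ballx.
    exact: nbhs_right_lt.
  move=> [x' e] /= [xx' er]; apply: Qsub Qr => y [Ky x'y]; split => //.
  rewrite [r]splitr; apply: ball_triangle xx' _.
  by apply: le_ball x'y; exact: ltW.
move=> ne; have [e [e0 Ke]] : exists e : R, 0 < e /\
    (K `<=` fun x => Q (K `&` ball x e))%classic.
  have := @filter_ex _ ((0^'+)%classic : set_system R) _ _ (filterI (nbhs_right_gt (0:R)) ne).
  by move=> [e [e0 Ke]]; exists e.
by exists e.
Qed.

(* A label (true, _) stands for the lower sector; (false, neg) for the left or
   right upper sector. *)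
Definition sector_switch (p q : bool * bool) : bool :=
  [&& ~~ p.1, ~~ q.1 & p.2 (+) q.2].

Definition trichromatic (s : seq (bool * bool)) : bool :=
  [&& has (fun p => p.1) s, has (fun p => ~~ p.1 && p.2) s
    & has (fun p => ~~ p.1 && ~~ p.2) s].

(** If no label is lower, two colours change an even number of times around the square; if an upper
    sector is missing, no side is a switch. *)
Lemma square_switch (p q r s : bool * bool) :
  ~~ trichromatic [:: p; q; r; s] ->
  sector_switch p q (+) sector_switch r s =
  sector_switch p r (+) sector_switch q s.
Proof.
by case: p => [[] []]; case: q => [[] []]; case: r => [[] []];
  case: s => [[] []].
Qed.

(** Summing the square identities over a strip between consecutive rows cancels the inner vertical
    edges, and the two outer ones are not switches. *)
Lemma row_switch_eq (lab : nat -> nat -> bool * bool) (n : nat) :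
  (forall i j, (i < n)%N -> (j < n)%N ->
     ~~ trichromatic [:: lab i j; lab i.+1 j; lab i j.+1; lab i.+1 j.+1]) ->
  (forall j, (j < n)%N -> ~~ sector_switch (lab 0 j) (lab 0 j.+1)) ->
  (forall j, (j < n)%N -> ~~ sector_switch (lab n j) (lab n j.+1)) ->
  \big[addb/false]_(i < n) sector_switch (lab i 0) (lab i.+1 0) =
  \big[addb/false]_(i < n) sector_switch (lab i n) (lab i.+1 n).
Proof.
move=> tri side0 siden.
pose row j m := \big[addb/false]_(i < m) sector_switch (lab i j) (lab i.+1 j).
suff eq_row j : (j <= n)%N -> row 0 n = row j n by exact: eq_row.
elim: j => // j IH jn; rewrite IH 1?ltnW //.
suff step m : (m <= n)%N -> row j m (+) row j.+1 m =
    sector_switch (lab 0 j) (lab 0 j.+1)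
      (+) sector_switch (lab m j) (lab m j.+1).
  have := step n (leqnn n).
  rewrite (negbTE (side0 _ jn)) (negbTE (siden _ jn)).
  by case: (row j n); case: (row j.+1 n).
elim: m => [|m IHm] mn; first by rewrite /row !big_ord0 !addbb.
have := square_switch (tri m j mn jn); have := IHm (ltnW mn).
have rowS j' : row j' m.+1 = row j' m (+) sector_switch (lab m j') (lab m.+1 j').
  by rewrite /row big_ord_recr.
rewrite !rowS; case: (row j m); case: (row j.+1 m);
  do 5 case: (sector_switch _ _) => //=.
Qed.

Lemma row_switch_upper (lab : nat -> bool * bool) (n : nat) :
  (forall i, (i <= n)%N -> ~~ (lab i).1) ->
  \big[addb/false]_(i < n) sector_switch (lab i) (lab i.+1) =
  (lab 0).2 (+) (lab n).2.
Proof.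
move=> up; elim: n up => [|n IH] up; first by rewrite big_ord0 addbb.
rewrite big_ord_recr /= IH => [|i /leqW /up //].
rewrite /sector_switch !up //=.
by case: (lab 0).2; case: (lab n).2; case: (lab n.+1).2.
Qed.

(* If the arcs do not meet, g s - h t never vanishes on the unit square; label it
   by one of three sectors (y < 0; y >= 0 and x < 0; y >= 0 and x >= 0). On a fine
   grid no small square carries all three labels, so each square meets evenly
   many edges between the two upper sectors. There are no such edges on the sides
   s = 0 and s = 1, an odd number on the side t = 0 and an even number on t = 1. *)
Lemma arcs_cross (R : realType) (g h : R -> R * R) (a b c d : R) :
  {within `[0, 1], continuous g}%classic ->
  {within `[0, 1], continuous h}%classic ->
  g 0 = (a, 0) -> g 1 = (c, 0) -> h 0 = (b, 0) -> h 1 = (d, 0) ->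
  a < b -> b < c -> c < d ->
  (forall t, 0 < t < 1 -> 0 < (g t).2) ->
  (forall t, 0 < t < 1 -> 0 < (h t).2) ->
  exists s t, [/\ 0 <= s <= 1, 0 <= t <= 1 & g s = h t].
Proof.
move=> cg ch g0 g1 h0 h1 ab bc cd gpos hpos; apply: contrapT => nomeet.
pose I : set R := `[0, 1]%classic.
pose K : set (R * R) := (I `*` I)%classic.
have inI t : I t <-> 0 <= t <= 1 by rewrite /I /= in_itv.
have gge t : 0 <= t <= 1 -> 0 <= (g t).2.
  move=> /andP[]; rewrite le_eqVlt => /predU1P[<- _|t0]; first by rewrite g0.
  rewrite le_eqVlt => /predU1P[->|t1]; first by rewrite g1.
  by rewrite ltW// gpos ?t0.
have hge t : 0 <= t <= 1 -> 0 <= (h t).2.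
  move=> /andP[]; rewrite le_eqVlt => /predU1P[<- _|t0]; first by rewrite h0.
  rewrite le_eqVlt => /predU1P[->|t1]; first by rewrite h1.
  by rewrite ltW// hpos ?t0.
pose u (p : R * R) := (g p.1).1 - (h p.2).1.
pose v (p : R * R) := (g p.1).2 - (h p.2).2.
have coord_cvg (f : R -> R * R) (pr : R * R -> R) (co : R * R -> R) p :
    {within I, continuous f}%classic -> continuous pr -> continuous co ->
    (forall q, K q -> I (pr q)) -> K p ->
    (co (f (pr q)) @[q --> within K (nbhs p)] --> co (f (pr p)))%classic.
  move=> /subspace_continuousP cf cpr cco Kpr Kp.
  apply: (cvg_comp (f \o pr) co _ (cco _)).
  apply: (cvg_comp pr f _ (cf _ (Kpr _ Kp))) => A /= IA.
  have := cpr p _ IA; rewrite /nbhs /= /within /=; apply: filterS => q /= IAq Kq.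
  exact/IAq/Kpr.
have cont_fst : continuous (fst : R * R -> R) by move=> x; exact: cvg_fst.
have cont_snd : continuous (snd : R * R -> R) by move=> x; exact: cvg_snd.
have cu p : K p -> (u q @[q --> within K (nbhs p)] --> u p)%classic.
  move=> Kp; apply: cvgB.
    exact: (coord_cvg g fst fst p cg cont_fst cont_fst (fun q => @proj1 _ _) Kp).
  exact: (coord_cvg h snd fst p ch cont_snd cont_fst (fun q => @proj2 _ _) Kp).
have cv p : K p -> (v q @[q --> within K (nbhs p)] --> v p)%classic.
  move=> Kp; apply: cvgB.
    exact: (coord_cvg g fst snd p cg cont_fst cont_snd (fun q => @proj1 _ _) Kp).
  exact: (coord_cvg h snd snd p ch cont_snd cont_snd (fun q => @proj2 _ _) Kp).
pose lab (p : R * R) := (v p < 0, u p < 0).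
pose Q (A : set (R * R)) := forall x y z, A x -> A y -> A z ->
  (lab x).1 -> ~~ (lab y).1 && (lab y).2 -> ~~ (lab z).1 && ~~ (lab z).2 -> False.
have cK : compact K by apply: compact_setX; exact: segment_compact.
have [|p Kp|e e0 Qe] := @lebesgue_number R _ K Q cK.
- by move=> A B AB QB x y z /AB Bx /AB By /AB Bz; exact: QB Bx By Bz.
- have nzF : v p != 0 \/ u p != 0.
    apply/orP; rewrite -negb_and; apply/negP => /andP[/eqP v0 /eqP u0].
    apply: nomeet; exists p.1, p.2; split; [exact/inI/Kp.1|exact/inI/Kp.2|].
    by apply/eqP; rewrite -subr_eq0; apply/eqP; congr pair.
  have ball_of (P : set (R * R)) : (\forall q \near p, K q -> P q) ->
      exists2 e : R, 0 < e & forall q, (K `&` ball p e)%classic q -> P q.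
    move=> /nbhs_ballP[e /= e0 He]; exists e => // q [Kq pq].
    exact: He.
  (* Near [p] some label is absent: the upper ones if [v p] is negative, the lower one if it is
     positive, and if [v p] is 0 the upper one opposite to the sign of [u p]. *)
  have [v0|v0|v0] := ltgtP (v p) 0.
  + have [|e e0 He] := ball_of (fun q => v q < 0).
      exact: cvgr_lt (cv p Kp) _ v0.
    exists e => // x y z _ /He vy _ _; rewrite /lab /= vy //.
  + have [|e e0 He] := ball_of (fun q => 0 < v q).
      exact: cvgr_gt (cv p Kp) _ v0.
    exists e => // x y z /He vx _ _; rewrite /lab /= => vx'.
    by have := lt_trans vx vx'; rewrite ltxx.
  + case: nzF; rewrite ?v0 ?eqxx // => u0.
    have [u1|u1|u1] := ltgtP (u p) 0; last by rewrite u1 eqxx in u0.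
    * have [|e e0 He] := ball_of (fun q => u q < 0).
        exact: cvgr_lt (cu p Kp) _ u1.
      by exists e => // x y z _ _ /He uz _ _; rewrite /lab /= uz andbF.
    * have [|e e0 He] := ball_of (fun q => 0 < u q).
        exact: cvgr_gt (cu p Kp) _ u1.
      exists e => // x y z _ /He uy _ _; rewrite /lab /= => /andP[_ uy'].
      by have := lt_trans uy uy'; rewrite ltxx.
(* The mesh [1/n] is below [e]. Also [n >= 2], so every grid edge on the sides s = 0 and s = 1 has
   an endpoint inside the side, where the label is lower. *)
pose n := (Num.truncn e^-1).+2.
have nR0 : 0 < n%:R :> R by rewrite ltr0n.
have nV : n%:R^-1 < e.
  rewrite -[ltRHS]invrK ltf_pV2 ?posrE ?invr_gt0 //.
  apply: lt_le_trans (truncnS_gt _) _; by rewrite ler_nat.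
pose x (i : nat) : R := i%:R / n%:R.
have x0 : x 0%N = 0 by rewrite /x mul0r.
have xn : x n = 1 by rewrite /x divff // gt_eqF.
have xI i : (i <= n)%N -> 0 <= x i <= 1.
  by move=> iN; rewrite divr_ge0 ?ler0n //= ler_pdivrMr // mul1r ler_nat.
have xS i : x i.+1 = x i + n%:R^-1 by rewrite /x -natr1 mulrDl mul1r.
have xI' i : (0 < i < n)%N -> 0 < x i < 1.
  by move=> /andP[i0 iN]; rewrite divr_gt0 ?ltr0n //= ltr_pdivrMr // mul1r ltr_nat.
have bx i : ball (x i) e (x i) by exact: ballxx.
have bxS i : ball (x i) e (x i.+1).
  by rewrite xS /ball /= opprD addNKr normrN gtr0_norm ?invr_gt0.
pose L i j := lab (x i, x j).
have nosw (j k : nat) : (0 < j < n)%N || (0 < k < n)%N -> forall f : nat -> bool * bool, (forall i, (0 < i < n)%N -> (f i).1) ->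
    ~~ sector_switch (f j) (f k).
  by move=> /orP[] ij f /(_ _ ij); rewrite /sector_switch => ->; rewrite ?andbF.
have eq_rows : \big[addb/false]_(i < n) sector_switch (L i 0%N) (L i.+1 0%N) =
    \big[addb/false]_(i < n) sector_switch (L i n) (L i.+1 n).
  apply: row_switch_eq.
  - move=> i j iN jN; apply/negP => /and3P[].
    have Kx k l : (k <= n)%N -> (l <= n)%N -> K (x k, x l).
      by move=> kN lN; split => /=; apply/inI/xI.
    have in_ball p : p \in [:: (x i, x j); (x i.+1, x j); (x i, x j.+1); (x i.+1, x j.+1)] ->
        (K `&` ball (x i, x j) e)%classic p.
      by rewrite !inE => /or4P[] /eqP->; split; try (by split => /=); apply: Kx => //;
        exact: ltnW.
    have unmap (P : pred (bool * bool)) :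
        has P [:: L i j; L i.+1 j; L i j.+1; L i.+1 j.+1] ->
        exists p, (K `&` ball (x i, x j) e)%classic p /\ P (lab p).
      rewrite -[X in has P X]/(map lab [:: (x i, x j); (x i.+1, x j); (x i, x j.+1); (x i.+1, x j.+1)]).
      by rewrite has_map => /hasP[p /in_ball bp Pp]; exists p.
    move=> /unmap[p [bp Pp]] /unmap[q [bq Pq]] /unmap[r [br Pr]].
    by apply: (Qe (x i, x j) _ p q r) => //; apply: Kx; exact: ltnW.
  - move=> j jN; apply: (nosw j j.+1 _ (fun j => L 0%N j)); first by lia.
    by move=> i /xI' /hpos hi; rewrite /L /lab /= /v /= x0 g0 /= sub0r oppr_lt0.
  - move=> j jN; apply: (nosw j j.+1 _ (fun j => L n j)); first by lia.
    by move=> i /xI' /hpos hi; rewrite /L /lab /= /v /= xn g1 /= sub0r oppr_lt0.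
move: eq_rows.
rewrite (@row_switch_upper (fun i => L i 0%N)); last first.
  by move=> i /xI /gge gi; rewrite /L /lab /= /v /= x0 h0 /= subr0 -leNgt.
rewrite (@row_switch_upper (fun i => L i n)); last first.
  by move=> i /xI /gge gi; rewrite /L /lab /= /v /= xn h1 /= subr0 -leNgt.
rewrite /L /lab /= /u /= x0 xn g0 g1 h0 h1 /= !subr_lt0 ab cd (lt_trans ab (lt_trans bc cd)).
by rewrite ltNge (ltW bc).
Qed.

(** * Counting quarter-plane excursions *)

(* A letter (u, l) tells whether a vertex opens (u) or closes an upper arc, and
   whether it is also an endpoint (l) of a lower arc, which it then closes or
   opens, respectively; a and b are the numbers of currently open upper and lower
   arcs. *)
Fixpoint quadrant_excursion (a b : nat) (w : seq (bool * bool)) : bool :=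
  match w with
  | [::] => (a == 0) && (b == 0)
  | (true, false) :: w' => quadrant_excursion a.+1 b w'
  | (false, false) :: w' => (0 < a) && quadrant_excursion a.-1 b w'
  | (false, true) :: w' => (0 < a) && quadrant_excursion a.-1 b.+1 w'
  | (true, true) :: w' => (0 < b) && quadrant_excursion a.+1 b.-1 w'
  end%N.

Lemma card_tuple_cons (T : finType) (n : nat) (P : pred (seq T)) :
  #|[set w : n.+1.-tuple T | P w]%SET| =
  (\sum_(x : T) #|[set w : n.-tuple T | P (x :: w)]%SET|)%N.
Proof.
under eq_bigr do rewrite -sum1dep_card.
rewrite pair_big_dep /= -sum1dep_card.
rewrite (reindex (fun p : T * n.-tuple T => [tuple of p.1 :: p.2])) //=.
exists (fun w : n.+1.-tuple T => (thead w, [tuple of behead w])) => [[x w]|w] _ /=.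
  by congr pair; apply: val_inj.
by rewrite [RHS]tuple_eta.
Qed.

Lemma sum_bool_pair (G : bool * bool -> nat) :
  (\sum_x G x =
   G (true, true) + G (true, false) + (G (false, true) + G (false, false)))%N.
Proof.
rewrite (eq_bigr (fun p => G (p.1, p.2))); last by case.
by rewrite -(pair_bigA _ (fun x y => G (x, y))) /= !big_bool.
Qed.

(** Unrestricted walks with steps 1 and -1 and total displacement [z]; taking [z] in [int] frees
    reflections from side conditions. *)
Fixpoint line_walks (n : nat) (z : int) : int :=
  if n is n'.+1 then line_walks n' (z - 1) + line_walks n' (z + 1)
  else (z == 0)%:R.

Lemma line_walksN n z : line_walks n (- z) = line_walks n z.
Proof.
elim: n z => [|n IH] z /=; first by rewrite oppr_eq0.
have -> : - z + 1 = - (z - 1) by ring.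
by rewrite -opprD !IH addrC.
Qed.

Lemma line_walks_out n (z : int) : z < - n%:Z -> line_walks n z = 0.
Proof.
elim: n z => [|n IH] z /= zn; first by rewrite lt_eqF.
by rewrite !IH //; lia.
Qed.

(** A walk with [m] steps up has displacement [2m - n]; the recursion is Pascal's rule. *)
Lemma line_walks_bin n (m : nat) : line_walks n (2 * m%:Z - n%:Z) = 'C(n, m)%:Z.
Proof.
elim: n m => [|n IH] m.
  by rewrite /= bin0n subr0; case: m.
case: m => [|m] /=.
  rewrite bin0 line_walks_out ?add0r; last by lia.
  by have := IH 0%N; rewrite bin0 => <-; congr line_walks; lia.
rewrite binS PoszD -!IH addrC; congr (_ + _); congr line_walks; lia.
Qed.

(* Reflection at -1: the walks of length n from i to j that stay >= 0. *)
Definition ballot (i : int) (n : nat) (j : int) : int :=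
  line_walks n (j - i) - line_walks n (j + i + 2).

Lemma ballotS i n j : ballot i n.+1 j = ballot i n (j - 1) + ballot i n (j + 1).
Proof.
rewrite /ballot /=.
have -> : j - 1 - i = j - i - 1 by ring.
have -> : j + 1 - i = j - i + 1 by ring.
have -> : j - 1 + i + 2 = j + i + 2 - 1 by ring.
have -> : j + 1 + i + 2 = j + i + 2 + 1 by ring.
by ring.
Qed.

(** At -1 the two terms are mirror images of each other. *)
Lemma ballotN1 i n : ballot i n (- 1) = 0.
Proof.
rewrite /ballot -line_walksN; apply/eqP; rewrite subr_eq0; apply/eqP.
by congr line_walks; ring.
Qed.

(* As the letters are read, (a, a + 2 b) performs two simultaneous +-1 walks on
   the nonnegative integers, the first staying weakly below the second. Shifting
   the second by 2 forbids them to meet, and the right-hand side is the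
   Lindstrom-Gessel-Viennot determinant of reflected walk counts. *)
Lemma card_quadrant_excursion n a b :
  #|[set w : n.-tuple _ | quadrant_excursion a b w]%SET|%:Z =
  ballot 2 n (a + 2 * b + 2)%N * ballot 0 n a
  - ballot 2 n a * ballot 0 n (a + 2 * b + 2)%N.
Proof.
elim: n a b => [|n IH] a b.
  have -> : #|[set w : 0.-tuple _ | quadrant_excursion a b w]%SET| =
      (a == 0%N) && (b == 0%N) :> nat.
    case: (boolP (_ && _)) => ab.
      rewrite (eq_card (B := predT)) ?card_tuple ?expn0 // => w.
      by rewrite inE tuple0 /= ab.
    by apply: eq_card0 => w; rewrite inE tuple0 /= (negbTE ab).
  have neq (z : int) : 0 < z -> (z == 0) = false by lia.
  rewrite /ballot /= !(neq (_ + _ + 2)) ?(neq ((_ + _)%N%:Z - 0)); lia.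
(* A guarded letter contributes 0 when its guard fails, so the determinant must vanish at the
   corresponding boundary points. *)
have card_cond (c : bool) (P : pred (n.-tuple (bool * bool))) (z : int) :
    (c -> #|[set w | P w]%SET|%:Z = z) -> (~~ c -> z = 0) ->
    #|[set w | c && P w]%SET|%:Z = z.
  case: c => [/(_ isT) <- //|_ /(_ isT) ->].
  by rewrite eq_card0 // => w; rewrite inE.
rewrite card_tuple_cons.
rewrite sum_bool_pair /= !PoszD.
set S : int := (a + 2 * b + 2)%N.
pose F (s t : int) := ballot 2 n s * ballot 0 n t - ballot 2 n t * ballot 0 n s.
have IHF a' b' (s t : int) : s = (a' + 2 * b' + 2)%N -> t = a' ->
    #|[set w : n.-tuple _ | quadrant_excursion a' b' w]%SET|%:Z = F s t.
  by move=> -> ->; exact: IH.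
have -> : #|[set w : n.-tuple _ | (0 < b)%N && quadrant_excursion a.+1 b.-1 w]%SET|%:Z
    = F (S - 1) (a%:Z + 1).
  apply: card_cond => [b0|]; first by apply: IHF; rewrite /S; lia.
  rewrite -eqn0Ngt => /eqP b0.
  (* For [b = 0] the two shifted walks would meet, and the determinant has two equal columns. *)
  have -> : S - 1 = a%:Z + 1 by rewrite /S b0; lia.
  by rewrite /F subrr.
have -> : #|[set w : n.-tuple _ | quadrant_excursion a.+1 b w]%SET|%:Z
    = F (S + 1) (a%:Z + 1) by apply: IHF; rewrite /S; lia.
have -> : #|[set w : n.-tuple _ | (0 < a)%N && quadrant_excursion a.-1 b.+1 w]%SET|%:Z
    = F (S + 1) (a%:Z - 1).
  apply: card_cond => [a0|]; first by apply: IHF; rewrite /S; lia.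
  (* For [a = 0] the first walk would reach -1, where the ballot numbers vanish. *)
  by rewrite -eqn0Ngt => /eqP->; rewrite /F sub0r !ballotN1 mulr0 mul0r subrr.
have -> : #|[set w : n.-tuple _ | (0 < a)%N && quadrant_excursion a.-1 b w]%SET|%:Z
    = F (S - 1) (a%:Z - 1).
  apply: card_cond => [a0|]; first by apply: IHF; rewrite /S; lia.
  by rewrite -eqn0Ngt => /eqP->; rewrite /F sub0r !ballotN1 mulr0 mul0r subrr.
by rewrite !ballotS /F; ring.
Qed.

Lemma card_excursions (k : nat) : (0 < k)%N ->
  #|[set w : (2 * k).-tuple _ | quadrant_excursion 0 0 w]%SET|%:R =
  ((2 * k)`!)%:R * ((2 * k + 2)`!)%:R * 6
    / ((k`!)%:R * ((k + 1)`!)%:R * ((k + 2)`!)%:R * ((k + 3)`!)%:R) :> rat.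
Proof.
case: k => // k _.
set n := (2 * k.+1)%N; set N := #|_|.
have W (m : nat) (z : int) : z = 2 * m%:Z - n%:Z ->
  line_walks n z = 'C(n, m)%:Z by move=> ->; exact: line_walks_bin.
(* Now [k.+1] is half the length. Displacements 0, 2, 4, 6 mean [k.+1], ..., [k.+4] steps up; the
   displacement -2 is reflected to 2. *)
have EN : N%:Z = ('C(n, k.+1)%:Z - 'C(n, k.+4)%:Z) * ('C(n, k.+1)%:Z - 'C(n, k.+2)%:Z)
    - ('C(n, k.+2)%:Z - 'C(n, k.+3)%:Z) * ('C(n, k.+2)%:Z - 'C(n, k.+3)%:Z).
  rewrite [LHS]card_quadrant_excursion /ballot.
  congr ((_ - _) * (_ - _) - (_ - _) * (_ - _)); try by apply: W; rewrite /n; lia.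
  by rewrite -line_walksN; apply: W; rewrite /n; lia.
have -> : N%:R = (N%:Z)%:~R :> rat by [].
rewrite {}EN !(rmorphB, rmorphM) /= -!pmulrn.
(* Ratios of neighbouring binomials turn every entry into a rational function of [x] times the
   central binomial [b0]. *)
have B (i j : nat) : (i + j = n)%N -> i.+1%:R * 'C(n, i.+1)%:R = j%:R * 'C(n, i)%:R :> rat.
  by move=> ij; rewrite -!natrM mul_bin_left -ij addKn.
have x0 : 0 <= k%:R :> rat by rewrite ler0n.
set x : rat := k%:R in x0 *.
have S1 : k.+2%:R = x + 2 :> rat by rewrite -natrD addn2.
have S2 : k.+3%:R = x + 3 :> rat by rewrite -natrD addn3.
have S3 : k.+4%:R = x + 4 :> rat by rewrite -natrD addn4.
set b0 : rat := 'C(n, k.+1)%:R in B *.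
have B1 : 'C(n, k.+2)%:R = b0 * (x + 1) / (x + 2).
  have := B k.+1 k.+1; rewrite S1 -natr1 -/x => BB; apply: (mulfI (x := x + 2)); first lra.
  by rewrite BB; [field; lra|rewrite /n; lia].
have B2 : 'C(n, k.+3)%:R = b0 * (x + 1) * x / ((x + 2) * (x + 3)).
  have := B k.+2 k; rewrite S2 B1 -/x => BB; apply: (mulfI (x := x + 3)); first lra.
  by rewrite BB; [field; lra|rewrite /n; lia].
have B3 : 'C(n, k.+4)%:R = b0 * (x + 1) * x * (x - 1) / ((x + 2) * (x + 3) * (x + 4)).
  apply: (mulfI (x := x + 4)); first lra.
  (* The predecessor of [k] truncates at [k = 0]; there the binomial is 0, and so is the factor
     [x]. *)
  case: (posnP k) => [k0|k0].
    by rewrite bin_small ?/n ?k0 // /x k0; field; rewrite -?/x; lra.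
  have := B k.+3 k.-1; rewrite S3 B2 => ->; last by rewrite /n; lia.
  have -> : k.-1%:R = x - 1 by rewrite /x -[in RHS](prednK k0) -natr1 addrK.
  by field; lra.
have F0 : n`!%:R = b0 * (k.+1)`!%:R * (k.+1)`!%:R :> rat.
  have kn : (k.+1 <= n)%N by rewrite /n; lia.
  by rewrite -(bin_fact kn) (_ : (n - k.+1 = k.+1)%N) ?natrM ?mulrA // /n; lia.
have f0 : (k.+1)`!%:R != 0 :> rat by rewrite pnatr_eq0 -lt0n fact_gt0.
have F2 : (n + 2)`!%:R = (2 * x + 4) * (2 * x + 3) * n`!%:R :> rat.
  rewrite addn2 2!factS !natrM mulrA; congr (_ * _ * _); rewrite /x /n; lra.
have Fk (m : nat) : m.+1`!%:R = m.+1%:R * m`!%:R :> rat by rewrite factS natrM.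
rewrite F2 addn1 addn2 addn3 (Fk k.+3) (Fk k.+2) (Fk k.+1) F0 B1 B2 B3 S1 S2 S3.
by field; do ?[split]; rewrite ?f0 //; lra.
Qed.

(** * Noncrossing matchings *)

Definition height (f : nat -> int) (i : nat) : int := \sum_(j < i) f j.

Lemma height0 f : height f 0 = 0.
Proof. exact: big_ord0. Qed.

Lemma heightS f i : height f i.+1 = height f i + f i.
Proof. exact: big_ord_recr. Qed.

Lemma height_cons f i : height f i.+1 = f 0%N + height (fun j => f j.+1) i.
Proof. exact: big_ord_recl. Qed.

(* The noncrossing matching of the up-steps of f with its down-steps. *)
Definition matched (f : nat -> int) (i j : nat) : Prop :=
  [/\ (i < j)%N, f i = 1, f j = -1, height f j.+1 = height f i
    & forall t, (i < t <= j)%N -> height f i < height f t].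

(** The earlier of two partners would bring the height back to [height f i], while the later one
    requires it to stay above. *)
Lemma matched_fun f i j j' : matched f i j -> matched f i j' -> j = j'.
Proof.
move=> [ij _ _ hj ltj] [ij' _ _ hj' ltj'].
have [jj'|jj'|//] := ltngtP j j'.
  by have := ltj' j.+1; rewrite hj ltxx; lia.
by have := ltj j'.+1; rewrite hj' ltxx; lia.
Qed.

Lemma matched_inj f i i' j : matched f i j -> matched f i' j -> i = i'.
Proof.
move=> [ij _ _ hj ltj] [ij' _ _ hj' ltj'].
have [ii'|ii'|//] := ltngtP i i'.
  by have := ltj i'; rewrite -hj -hj' ltxx; lia.
by have := ltj' i; rewrite -hj -hj' ltxx; lia.
Qed.

(** The inner arc starts strictly higher than [height f i], and step [j] returns to that level, so
    the inner arc is closed before. *)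
Lemma matched_noncrossing f i j i' j' : matched f i j -> matched f i' j' ->
  (i < i')%N -> (i' < j)%N -> (j' < j)%N.
Proof.
move=> [ij _ _ hj ltj] [ij' _ _ hj' ltj'] ii' i'j.
have hi' : height f i < height f i' by apply: ltj; lia.
rewrite ltnNge leq_eqVlt; apply/negP => /predU1P[jj'|jj'].
  by move: hi'; rewrite -hj' -jj' hj ltxx.
have := ltj' j.+1; rewrite hj => h; have := lt_trans hi' (h _).
by rewrite ltxx; lia.
Qed.

(** The partner is the step of first return to a height at most [height f i]; descents are by at
    most 1, so the level is not skipped. *)
Lemma matched_opener f m i : (forall j, -1 <= f j) -> height f m <= height f i ->
  (i < m)%N -> f i = 1 -> exists2 j, (j < m)%N & matched f i j.
Proof.
move=> f_ge hm im fi.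
have exP : exists t, (i < t)%N && (height f t <= height f i).
  by exists m; rewrite im.
case: (ex_minnP exP) => -[//|j] /andP[ij hj] minj.
have above t : (i < t <= j)%N -> height f i < height f t.
  move=> /andP[it tj]; rewrite ltNge; apply/negP => ht.
  by have := minj t; rewrite it ht => /(_ isT); lia.
have jm : (j < m)%N by apply: minj; rewrite im.
have ij' : (i < j)%N.
  by move: ij hj; rewrite ltnS leq_eqVlt => /predU1P[<-|//]; rewrite heightS fi; lia.
have hij : height f i < height f j by apply: above; rewrite ij' leqnn.
have := f_ge j; rewrite heightS in hj => fj.
by exists j => //; split => //; rewrite ?heightS; lia.
Qed.

(** The partner leaves the last point up to [j] of height at most [height f j.+1]; time 0 is such a
    point. *)
Lemma matched_closer f j : (forall i, f i <= 1) -> 0 <= height f j.+1 ->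
  f j = -1 -> exists i, matched f i j.
Proof.
move=> f_le hj fj.
have exP : exists t, (t <= j)%N && (height f t <= height f j.+1).
  by exists 0%N; rewrite height0.
have leP t : (t <= j)%N && (height f t <= height f j.+1) -> (t <= j)%N by case/andP.
case: (ex_maxnP exP leP) => i /andP[ij hi] maxi.
have above t : (i < t <= j)%N -> height f j.+1 < height f t.
  move=> /andP[it tj]; rewrite ltNge; apply/negP => ht.
  by have := maxi t; rewrite tj ht => /(_ isT); lia.
have ij' : (i < j)%N.
  move: ij hi; rewrite leq_eqVlt => /predU1P[->|//]; rewrite heightS fj; lia.
have hij : height f j.+1 < height f i.+1 by apply: above; rewrite ltnSn.
have := f_le i; rewrite (heightS f i) in hij => fi.
have hE : height f j.+1 = height f i by lia.
by exists i; split => //; [lia|move=> t /above; rewrite hE].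
Qed.

Lemma height_ord m f q p : (p <= q <= m)%N ->
  height f q = height f p + \sum_(v < m | (p <= v < q)%N) f v.
Proof.
move=> /andP[pq qm]; rewrite /height -!(big_mkord xpredT f).
rewrite (@big_cat_nat _ _ _ p) //=; congr (_ + _).
rewrite (big_nat_widen p q m) // (big_nat_widenl p 0) // big_mkord.
by apply: eq_bigl => v; rewrite andbC.
Qed.

(** Out-degree minus in-degree: for arcs oriented to the right, the change at [v] in the number of
    open arcs. *)
Definition net (m : nat) (U : rel 'I_m) (v : 'I_m) : int :=
  \sum_w ((U v w)%:Z - (U w v)%:Z).

(* The terms with both v and w in S cancel by antisymmetry. *)
Lemma sum_net m (U : rel 'I_m) (S : pred 'I_m) :
  \sum_(v | S v) net U v =
  \sum_(v | S v) \sum_(w | ~~ S w) ((U v w)%:Z - (U w v)%:Z).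
Proof.
have -> : \sum_(v | S v) net U v =
    \sum_(v | S v) \sum_(w | S w) ((U v w)%:Z - (U w v)%:Z)
    + \sum_(v | S v) \sum_(w | ~~ S w) ((U v w)%:Z - (U w v)%:Z).
  by rewrite -big_split; apply: eq_bigr => v _; rewrite /net (bigID S).
rewrite [X in X + _](_ : _ = 0) ?add0r //.
under eq_bigr do rewrite big_split sumrN /=.
rewrite big_split sumrN /= [X in X - _]exchange_big /=.
exact: subrr.
Qed.

(** By [sum_net] the increment is the number of arcs leaving the interval minus the number entering
    it, and the hypothesis excludes the latter. *)
Lemma height_le m (U : rel 'I_m) (f : nat -> int) p q : (forall v : 'I_m, f v = net U v) ->
  (p <= q <= m)%N ->
  (forall v w, U v w -> (p <= w < q)%N -> (p <= v < q)%N) ->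
  height f p <= height f q.
Proof.
move=> fU pqm closed; rewrite (height_ord f pqm) lerDl.
under eq_bigr do rewrite fU.
rewrite (sum_net U (fun v : 'I_m => (p <= v < q)%N)).
apply: sumr_ge0 => v Sv; apply: sumr_ge0 => w Sw.
have -> : U w v = false by apply: contraNF Sw => /closed; exact.
by rewrite subr0.
Qed.

Lemma height_ge m (U : rel 'I_m) (f : nat -> int) p q : (forall v : 'I_m, f v = net U v) ->
  (p <= q <= m)%N ->
  (forall v w, U v w -> (p <= v < q)%N -> (p <= w < q)%N) ->
  height f q <= height f p.
Proof.
move=> fU pqm closed; rewrite (height_ord f pqm) gerDl.
under eq_bigr do rewrite fU.
rewrite (sum_net U (fun v : 'I_m => (p <= v < q)%N)).
apply: sumr_le0 => v Sv; apply: sumr_le0 => w Sw.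
have -> : U v w = false by apply: contraNF Sw => /closed; exact.
by rewrite sub0r oppr_le0.
Qed.

Lemma height_net_ge0 m (U : rel 'I_m) (f : nat -> int) t : (forall v : 'I_m, f v = net U v) ->
  (forall v w, U v w -> (v < w)%N) -> (t <= m)%N -> 0 <= height f t.
Proof.
move=> fU Ult tm; rewrite -(height0 f); apply: (height_le fU) => // v w /Ult vw.
by move=> /andP[_ /(ltn_trans vw) ->].
Qed.

Lemma height_net_end m (U : rel 'I_m) (f : nat -> int) : (forall v : 'I_m, f v = net U v) ->
  height f m = 0.
Proof.
move=> fU; apply/eqP; rewrite eq_le -(height0 f).
by apply/andP; split; [apply: (height_ge fU)|apply: (height_le fU)];
  rewrite ?leqnn // => v w _ _; exact: ltn_ord.
Qed.

(** Noncrossing arcs are recovered from heights. Arcs ending strictly between [v] and [w] start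
    there and conversely, so the height stays at least [height f v.+1] in between and equals it at
    [w]. *)
Lemma matched_net m (U : rel 'I_m) (f : nat -> int) : (forall v : 'I_m, f v = net U v) ->
  (forall v w, U v w -> [/\ (v < w)%N, f v = 1 & f w = -1]) ->
  (forall v w w', U v w -> U v w' -> w = w') ->
  (forall v w v' w', U v w -> U v' w' -> (v < v')%N -> (v' < w)%N -> (w' < w)%N) ->
  forall v w, U v w -> matched f v w.
Proof.
move=> fU Uf Ufun Ucross v w Uvw; have [vw fv fw] := Uf v w Uvw.
have wm := ltn_ord w.
have hS t : (v < t <= w)%N -> height f v.+1 <= height f t.
  move=> /andP[vt tw]; apply: (height_le fU); first by lia.
  move=> x y Uxy /andP[vy yt]; have [xy _ _] := Uf x y Uxy.
  have [xv|vx|xv] := ltngtP x v; last 1 first.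
  - by move: Uxy; rewrite (val_inj xv) => /(Ufun _ _ _ Uvw) yw; move: yt; rewrite -yw; lia.
  - by have := Ucross _ _ _ _ Uxy Uvw xv vy; lia.
  - by lia.
have hw : height f w <= height f v.+1.
  apply: (height_ge fU); first by lia.
  move=> x y Uxy /andP[vx xw]; have [xy _ _] := Uf x y Uxy.
  by have := Ucross _ _ _ _ Uvw Uxy vx xw; lia.
have := hS w; rewrite vw leqnn => /(_ isT); rewrite heightS fv in hw hS *.
by split => //; [rewrite heightS fw; lia|move=> t /hS; lia].
Qed.

(** * Increasing paths as graph components *)

Definition edges_of (m : nat) (N : rel 'I_m) : {set {set 'I_m}} :=
  [set [set p.1; p.2]%SET | p : 'I_m * 'I_m & N p.1 p.2]%SET.

Lemma set2_lt_inj m (i j i' j' : 'I_m) : (i < j)%N -> (i' < j')%N ->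
  [set i; j]%SET = [set i'; j']%SET -> i = i' /\ j = j'.
Proof.
move=> ij ij' eqs.
have : i \in [set i'; j']%SET by rewrite -eqs set21.
have : j \in [set i'; j']%SET by rewrite -eqs set22.
have : i' \in [set i; j]%SET by rewrite eqs set21.
rewrite !inE => /orP[]/eqP i'E /orP[]/eqP jE /orP[]/eqP iE; split; subst => //; lia.
Qed.

Section IncreasingRelation.
Variables (m : nat) (N : rel 'I_m).
Hypothesis N_lt : forall i j : 'I_m, N i j -> (i < j)%N.

Lemma mem_edges_of (i j : 'I_m) : (i < j)%N -> ([set i; j]%SET \in edges_of N) = N i j.
Proof.
move=> ij; apply/imsetP/idP => [[[x y]]|Nij]; last by exists (i, j) => //; rewrite inE.
by rewrite inE /= => Nxy /(set2_lt_inj ij (N_lt Nxy))[-> ->].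
Qed.

Lemma adj_edges_of (x y : 'I_m) : adj (edges_of N) x y = N x y || N y x.
Proof.
rewrite /adj; have [xy|yx|/val_inj xy] := ltngtP x y.
- rewrite mem_edges_of //; have [//|_ /=] := boolP (N x y).
  by apply/esym; apply: contraTF xy => /N_lt; lia.
- rewrite finset.setUC mem_edges_of //; have [|_] := boolP (N y x); rewrite ?orbT ?orbF //.
  by apply/esym; apply: contraTF yx => /N_lt; lia.
- subst y; rewrite orbb; have -> : N x x = false by apply/negP => /N_lt; rewrite ltnn.
  apply/negP => /imsetP[[a b]]; rewrite inE /= => /N_lt ab /setP eqs.
  have := eqs a; have := eqs b; rewrite !inE !eqxx orbT => /orP[]/eqP bx /orP[]/eqP ax;
    subst; lia.
Qed.

Hypothesis N_fun : forall i j j', N i j -> N i j' -> j = j'.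
Hypothesis N_inj : forall i i' j, N i j -> N i' j -> i = i'.

(** Successors in [N] are unique, so [z] is the next vertex of the path. The relation [e] carries
    extra information on consecutive vertices, later the alternation of colours. *)
Lemma path_succ (e : rel 'I_m) x s y z : path N x s -> path e x s ->
  y \in x :: s -> N y z -> y = last x s \/ (z \in s /\ e y z).
Proof.
elim: s x => [|x' s IH] x /=; first by move=> _ _; rewrite inE => /eqP->; left.
move=> /andP[Nxx' pN] /andP[exx' pe]; rewrite inE => /predU1P[->|ys] Nyz.
  by right; rewrite -(N_fun Nxx' Nyz) inE eqxx.
have [->|[zs eyz]] := IH _ pN pe ys Nyz; [by left|right].
by rewrite inE zs orbT.
Qed.

Lemma path_pred x s y z : path N x s -> y \in x :: s -> N z y ->
  y = x \/ z \in x :: s.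
Proof.
elim: s x => [|x' s IH] x /=; first by rewrite inE => _ /eqP->; left.
move=> /andP[Nxx' pN]; rewrite inE => /predU1P[->|ys] Nzy; first by left.
right; have [yx'|zs] := IH _ pN ys Nzy; last by rewrite inE zs orbT.
by rewrite inE (N_inj Nxx' (i' := z)) ?eqxx // -yx'.
Qed.

Lemma path_edges_sub x s e : path N x s -> e \in path_edges (x :: s) ->
  exists y z, [/\ e = [set y; z]%SET, N y z, y \in x :: s & z \in x :: s].
Proof.
elim: s x => [|x' s IH] x //= /andP[Nxx' pN].
rewrite /path_edges /= inE => /predU1P[->|es].
  by exists x, x'; split => //; rewrite !inE eqxx ?orbT.
have [y [z [-> Nyz ys zs]]] := IH _ pN es.
by exists y, z; split => //; rewrite inE ?ys ?zs orbT.
Qed.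

Lemma mem_path_edges x s y z : path N x s -> y \in x :: s -> N y z ->
  y = last x s \/ [set y; z]%SET \in path_edges (x :: s).
Proof.
move=> pN ys Nyz; rewrite /path_edges.
elim: s x pN ys => [|x' s IH] x /=; first by rewrite inE => _ /eqP->; left.
move=> /andP[Nxx' pN]; rewrite inE => /predU1P[yx|ys].
  by right; rewrite yx in Nyz *; rewrite -(N_fun Nxx' Nyz) inE eqxx.
have [->|es] := IH _ pN ys; [by left|right].
by rewrite inE es orbT.
Qed.

(** A path that extends at neither end is closed under adjacency, hence is a whole component. *)
Lemma chain_wave_component x s : s != [::] -> path N x s ->
  (forall y, ~~ N y x) -> (forall y, ~~ N (last x s) y) ->
  wave_component (edges_of N) (x :: s).
Proof.
move=> s0 pN first_x last_s.
have closed_s : fingraph.closed (adj (edges_of N)) (mem (x :: s)).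
  have stay a b : adj (edges_of N) a b -> a \in x :: s -> b \in x :: s.
    rewrite adj_edges_of => /orP[Nab|Nba] as_.
      have [aE|[bs _]] := path_succ pN pN as_ Nab; last by rewrite inE bs orbT.
      by have := last_s b; rewrite -aE Nab.
    have [aE|//] := path_pred pN as_ Nba.
    by have := first_x b; rewrite -aE Nba.
  apply: intro_closed stay; apply: sym_connect_sym => a b.
  by rewrite !adj_edges_of orbC.
have sym_adj : connect_sym (adj (edges_of N)).
  by apply: sym_connect_sym => a b; rewrite !adj_edges_of orbC.
have padj : path (adj (edges_of N)) x s.
  by apply: sub_path pN => a b; rewrite adj_edges_of => ->.
split.
- by case: s s0 {pN last_s closed_s padj}.
- by rewrite /= (sub_path N_lt).
- move=> z zs; apply/setP => y; rewrite !inE.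
  apply/idP/idP => [ys|/(closed_connect closed_s) zy]; last first.
    by rewrite -in_cons -[_ \in _]zy.
  by rewrite (connect_trans _ (path_connect padj _)) ?inE // sym_adj (path_connect padj).
- apply/setP => e; rewrite !inE; apply/andP/idP => [[/imsetP[[a b]]]|es].
    rewrite inE /= => Nab -> sub.
    have as_ : a \in x :: s by have := fintype.subsetP sub a; rewrite !inE eqxx; apply.
    have [aE|//] := mem_path_edges pN as_ Nab.
    by have := last_s b; rewrite -aE Nab.
  have [y [z [-> Nyz ys zs]]] := path_edges_sub pN es.
  rewrite mem_edges_of ?N_lt //; split => //.
  by apply/fintype.subsetP => t; rewrite !inE => /orP[]/eqP->; rewrite -in_cons.
Qed.

Lemma chain_right v : exists2 s, path N v s & forall y, ~~ N (last v s) y.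
Proof.
have [n] := ubnP (m - v); elim: n v => // n IH v vn.
have [/existsP[y Nvy]|noy] := boolP [exists y, N v y]; last first.
  by exists [::] => //= y; rewrite (negbTE (existsPn noy y)).
have [|s ps ls] := IH y; first by have := N_lt Nvy; have := ltn_ord y; lia.
by exists (y :: s) => //=; rewrite Nvy.
Qed.

Lemma chain_left v s : path N v s -> exists x s', [/\ path N x s',
  last x s' = last v s, {subset v :: s <= x :: s'} & forall y, ~~ N y x].
Proof.
have [n] := ubnP v; elim: n v s => // n IH v s vn ps.
have [/existsP[y Nyv]|noy] := boolP [exists y, N y v]; last first.
  by exists v, s; split => // y; rewrite (negbTE (existsPn noy y)).
have [|/=|x [s' [ps' ls' sub nox]]] := IH y (v :: s); first by have := N_lt Nyv; lia.
  by rewrite Nyv.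
by exists x, s'; split => // z zs; apply: sub; rewrite inE zs orbT.
Qed.
End IncreasingRelation.

Definition edge_lt (m : nat) (E : {set {set 'I_m}}) : rel 'I_m :=
  fun i j => (i < j)%N && ([set i; j]%SET \in E).

Lemma edges_of_edge_lt m (E : {set {set 'I_m}}) :
  simple_graph E -> edges_of (edge_lt E) = E.
Proof.
move=> simE; apply/setP => e; apply/imsetP/idP => [[[i j]]|eE].
  by rewrite inE => /andP[_ /= ijE] ->.
have [x [y [xy eE']]] := elimT (cards2P e) (introT eqP (simE e eE)).
have := xy; rewrite -(inj_eq val_inj) neq_ltn => /orP[xy'|yx].
  by exists (x, y) => //; rewrite inE /edge_lt /= xy' -eE'.
rewrite finset.setUC in eE'.
by exists (y, x) => //; rewrite inE /edge_lt /= yx -eE'.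
Qed.

(** An edge of the tail that starts at [v] puts [v] beyond [x], so the first edge and a later one
    cannot both start at [v]. *)
Lemma path_edges_fun m (x v y y' : 'I_m) s : path (fun i j : 'I_m => i < j)%N x s ->
  (v < y)%N -> (v < y')%N -> [set v; y]%SET \in path_edges (x :: s) ->
  [set v; y']%SET \in path_edges (x :: s) -> y = y'.
Proof.
elim: s x => // x' s IH x /= /andP[xx' ps] vy vy'; rewrite /path_edges /= !inE.
have above (z : 'I_m) : (v < z)%N -> [set v; z]%SET \in path_edges (x' :: s) -> (x < v)%N.
  move=> vz /(path_edges_sub ps)[a [b [/(set2_lt_inj vz) eqs ab as_ _]]].
  have [-> _] := eqs ab; move: as_; rewrite inE => /predU1P[->//|as_].
  have tr : transitive (fun i j : 'I_m => i < j)%N by move=> ? ? ?; exact: ltn_trans.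
  by apply: ltn_trans xx' _; have /allP := order_path_min tr ps; apply.
move=> /predU1P[/(set2_lt_inj vy xx')[vx ->]|es] /predU1P[/(set2_lt_inj vy' xx')[vx' ->]|es'] //.
- by have := above _ vy' es'; rewrite vx ltnn.
- by have := above _ vy es; rewrite vx' ltnn.
- exact: IH ps vy vy' es es'.
Qed.

Lemma path_edges_inj m (x v y y' : 'I_m) s : path (fun i j : 'I_m => i < j)%N x s ->
  (y < v)%N -> (y' < v)%N -> [set y; v]%SET \in path_edges (x :: s) ->
  [set y'; v]%SET \in path_edges (x :: s) -> y = y'.
Proof.
elim: s x => // x' s IH x /= /andP[xx' ps] yv y'v; rewrite /path_edges /= !inE.
have above (z : 'I_m) : (z < v)%N -> [set z; v]%SET \in path_edges (x' :: s) -> (x' < v)%N.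
  move=> zv /(path_edges_sub ps)[a [b [/(set2_lt_inj zv) eqs ab as_ _]]].
  have [za ->] := eqs ab; move: as_; rewrite inE => /predU1P[<-//|as_].
  have tr : transitive (fun i j : 'I_m => i < j)%N by move=> ? ? ?; exact: ltn_trans.
  by apply: ltn_trans ab; have /allP := order_path_min tr ps; apply.
move=> /predU1P[/(set2_lt_inj yv xx')[-> vx]|es] /predU1P[/(set2_lt_inj y'v xx')[-> vx']|es'] //.
- by have := above _ y'v es'; rewrite vx ltnn.
- by have := above _ yv es; rewrite vx' ltnn.
- exact: IH ps yv y'v es es'.
Qed.

Section WaveComponent.
Variables (m : nat) (E : {set {set 'I_m}}) (p : seq 'I_m).
Hypothesis wave_p : wave_component E p.

Lemma adj_wave_component x y : x \in p -> adj E x y ->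
  y \in p /\ [set x; y]%SET \in path_edges p.
Proof.
case: wave_p => _ _ comp edges xp xy.
have yp : y \in p.
  have : y \in [set z in p]%SET by rewrite (comp x xp) inE connect1.
  by rewrite inE.
split => //; have : [set x; y]%SET \in [set e in path_edges p]%SET.
  rewrite -edges inE; apply/andP; split => //.
  by apply/fintype.subsetP => z; rewrite !inE => /orP[]/eqP->.
by rewrite inE.
Qed.

(** Converse of [chain_wave_component]. An edge into the head or out of the last vertex would join
    it to a vertex of [p], against the increasing order. *)
Lemma wave_component_chain : exists x s, [/\ p = x :: s, s != [::],
  path (edge_lt E) x s, forall y, ~~ edge_lt E y x
  & forall y, ~~ edge_lt E (last x s) y].
Proof.
case: wave_p => size_p sorted_p _ edges.
have pE e : e \in path_edges p -> e \in E.
  move=> ep; have : e \in [set e in path_edges p]%SET by rewrite inE.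
  by rewrite -edges inE => /andP[].
have tr : transitive (fun i j : 'I_m => i < j)%N by move=> ? ? ?; exact: ltn_trans.
have adj_p := @adj_wave_component.
case: p size_p sorted_p pE adj_p => [//|x s] size_p ps pE adj_p.
exists x, s; split => //.
- by case: s size_p {ps pE adj_p}.
- elim: s x ps pE {size_p adj_p} => //= x' s IH x /andP[xx' ps] pE.
  rewrite /edge_lt xx' pE ?mem_head //=; apply: IH => // e es.
  by apply: pE; rewrite /path_edges /= inE es orbT.
- move=> y; apply/negP => /andP[yx yxE].
  have [|ys _] := adj_p x y (mem_head _ _); first by rewrite /adj finset.setUC.
  move: ys; rewrite inE => /predU1P[yx'|ys]; first by rewrite yx' ltnn in yx.
  by have /allP/(_ _ ys) := order_path_min tr ps; lia.
- move=> y; apply/negP => /andP[xy xyE].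
  have [ys _] := adj_p _ y (mem_last _ _) xyE.
  suff : (y <= last x s)%N by lia.
  move: ys; rewrite inE => /predU1P[->|ys].
    case/lastP: s ps {size_p pE adj_p xy xyE} => // s z ps; rewrite last_rcons.
    by have /allP/(_ z) := order_path_min tr ps; rewrite mem_rcons mem_head => /(_ isT)/ltnW.
  case/splitPr: ys ps => s1 s2; rewrite /= cat_path last_cat /= => /and3P[_ _].
  case/lastP: s2 => // s2 z ps; rewrite last_rcons.
  by have /allP/(_ z) := order_path_min tr ps; rewrite mem_rcons mem_head => /(_ isT)/ltnW.
Qed.

Lemma edge_lt_path_edges v y : v \in p -> edge_lt E v y ->
  [set v; y]%SET \in path_edges p.
Proof. by move=> vp /andP[_ vyE]; case: (adj_wave_component vp vyE). Qed.

Lemma path_edges_edge_lt v y : v \in p -> edge_lt E y v ->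
  [set y; v]%SET \in path_edges p.
Proof.
move=> vp /andP[_]; rewrite finset.setUC => vyE.
by case: (adj_wave_component vp vyE).
Qed.

Lemma edge_lt_fun v y y' : v \in p -> edge_lt E v y -> edge_lt E v y' -> y = y'.
Proof.
move=> vp vy vy'; have vyp := edge_lt_path_edges vp vy.
have vyp' := edge_lt_path_edges vp vy'.
have [x [s [pE _ ps _ _]]] := wave_component_chain; rewrite pE in vyp vyp'.
have [/andP[vy0 _] /andP[vy0' _]] := (vy, vy').
by apply: path_edges_fun vy0 vy0' vyp vyp'; apply: sub_path ps => a b /andP[].
Qed.

Lemma edge_lt_inj v y y' : v \in p -> edge_lt E y v -> edge_lt E y' v -> y = y'.
Proof.
move=> vp vy vy'; have vyp := path_edges_edge_lt vp vy.
have vyp' := path_edges_edge_lt vp vy'.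
have [x [s [pE _ ps _ _]]] := wave_component_chain; rewrite pE in vyp vyp'.
have [/andP[vy0 _] /andP[vy0' _]] := (vy, vy').
by apply: path_edges_inj vy0 vy0' vyp vyp'; apply: sub_path ps => a b /andP[].
Qed.
End WaveComponent.

(** A vertex gets the side of the edge starting there. As the last vertex has colour false,
    alternation up to it also says that the last edge is upper. *)
Lemma alternating_edges m (f : {set 'I_m} -> bool) (u : pred 'I_m) x s :
  s != [::] -> path (fun a b => f [set a; b]%SET == u a) x s ->
  ~~ u (last x s) ->
  let q := map f (path_edges (x :: s)) in
  [/\ head false q, sorted (fun a b => a != b) q & last false q] <->
  u x /\ path (fun a b => u a != u b) x s.
Proof.
case/lastP: s => // s z _ pf; rewrite last_rcons => uz.
have -> : map f (path_edges (x :: rcons s z)) = map u (x :: s).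
  rewrite -(belast_rcons x s z); elim: (rcons s z) x pf => //= y t IH x.
  by move=> /andP[/eqP <- /IH <-].
rewrite /= rcons_path path_map last_map (negbTE uz).
by case: (u (last x s)); case: (u x); case: (path _ x s); split => // -[].
Qed.

(** * Drawings *)

(* N i j means that {i, j} is an edge with i < j; u v holds when the edge starting
   at v is in the upper half-plane, and fails when no edge starts at v. *)
Record wave_coloring (m : nat) (N : rel 'I_m) (u : pred 'I_m) : Prop := {
  coloring_lt : forall i j, N i j -> (i < j)%N;
  coloring_fun : forall i j j', N i j -> N i j' -> j = j';
  coloring_inj : forall i i' j, N i j -> N i' j -> i = i';
  coloring_alt : forall i j, N i j -> u j = ~~ u i;
  coloring_first : forall j, (forall i, ~~ N i j) -> u j;
  coloring_last : forall i, (forall j, ~~ N i j) -> ~~ u i;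
  coloring_cross : forall i j i' j', N i j -> N i' j' -> u i = u i' ->
    (i < i')%N -> (i' < j)%N -> (j' < j)%N }.

Definition parabola (R : realType) (up : bool) (a b : R) : set (R * R) :=
  [set z | a <= z.1 <= b /\ z.2 = (-1) ^+ (~~ up) * ((z.1 - a) * (b - z.1))]%classic.

Lemma parabola_arc (R : realType) (up : bool) (a b : R) : a < b ->
  arc_in_half_plane up (a, 0) (b, 0) (parabola up a b).
Proof.
move=> ab; pose x (t : R) := a + t * (b - a).
exists (fun t => (x t, (-1) ^+ (~~ up) * ((x t - a) * (b - x t)))).
have ba0 : b - a != 0 by rewrite subr_eq0 gt_eqF.
have cx : continuous x.
  move=> t; apply: cvgD; first exact: cvg_cst.
  by apply: cvgM; [exact: cvg_id|exact: cvg_cst].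
have cy : continuous (fun t => (-1) ^+ (~~ up) * ((x t - a) * (b - x t))).
  move=> t; apply: cvgM; first exact: cvg_cst.
  by apply: cvgM; apply: cvgB; [exact: cx|exact: cvg_cst|exact: cvg_cst|exact: cx].
split => /=.
- split.
    by apply: continuous_subspaceT => t; exact: cvg_pair (cx t) (cy t).
  move=> s t _ _ [/addrI /(mulIf ba0) st _]; exact: st.
- by rewrite /x mul0r addr0 subrr mul0r mulr0.
- by rewrite /x mul1r addrC subrK subrr !mulr0.
- move=> z [t /=]; rewrite in_itv /= => /andP[t0 t1] <-.
  have : 0 < (x t - a) * (b - x t).
    by rewrite /x; apply: mulr_gt0; nra.
  rewrite /half_plane /=; case: (up) => /=; rewrite ?mul1r //.
  by rewrite expr1 mulN1r oppr_lt0.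
- apply/seteqP; split => [z [t /=]|[z1 z2] [/= /andP[az zb] ->]].
    rewrite in_itv /= => /andP[t0 t1] <-; split => //=.
    by rewrite /x; apply/andP; split; nra.
  have xE : x ((z1 - a) / (b - a)) = z1 by rewrite /x divfK // addrC subrK.
  exists ((z1 - a) / (b - a)); last by rewrite xE.
  rewrite /= in_itv /= divr_ge0 ?subr_ge0 ?(ltW ab) //=.
  by rewrite ler_pdivrMr ?subr_gt0 // mul1r lerD2r.
Qed.

(** For nested intervals both factors of the outer parabola are strictly larger above the inner
    interval; otherwise the abscissas are disjoint. *)
Lemma parabola_nested (R : realType) (up : bool) (a b c d : R) (z : R * R) :
  a < c -> d < b \/ b < c -> parabola up a b z -> ~ parabola up c d z.
Proof.
move=> ac cdb [/andP[az zb] zE] [/andP[cz zd]]; rewrite zE => /(can_inj (signrMK _)).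
move=> E; case: cdb => cdb; nra.
Qed.

(** One ordinate is nonnegative and the other nonpositive, so both vanish. *)
Lemma parabola_opposite (R : realType) (a b c d : R) (z : R * R) :
  a < b -> c < d -> parabola true a b z -> parabola false c d z ->
  (z = (a, 0) \/ z = (b, 0)) /\ (z = (c, 0) \/ z = (d, 0)).
Proof.
case: z => z1 z2 ab cd [/= /andP[az zb]]; rewrite expr0 mul1r => ->.
move=> [/= /andP[cz zd]]; rewrite expr1 mulN1r => E.
have P0 : (z1 - a) * (b - z1) = 0 by nra.
have Q0 : (z1 - c) * (d - z1) = 0 by nra.
rewrite P0.
have end_pt x y : (z1 - x) * (y - z1) = 0 -> z1 = x \/ z1 = y.
  by move/eqP; rewrite mulf_eq0 !subr_eq0 => /orP[/eqP->|/eqP->]; [left|right].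
by split; [case: (end_pt a b P0) => ->|case: (end_pt c d Q0) => ->]; [left|right|left|right].
Qed.

Lemma vertex_point_inj (R : realType) m : injective (@vertex_point R m).
Proof.
move=> v w [] /eqP; rewrite eqr_nat eqSS => /eqP vw; exact: val_inj.
Qed.

Lemma wave_coloring_graph (R : realType) m (N : rel 'I_m) (u : pred 'I_m) :
  wave_coloring N u -> plane_symplectic_wave_graph R (edges_of N).
Proof.
move=> [Nlt Nfun Ninj alt first_u last_u cross].
have edge_ltE : edge_lt (edges_of N) =2 N.
  move=> i j; rewrite /edge_lt; have [ij|ij] := boolP (i < j)%N.
    by rewrite mem_edges_of.
  by apply/esym; apply: contraNF ij => /Nlt.
have mem_edges e : e \in edges_of N -> exists i j, N i j /\ e = [set i; j]%SET.
  by case/imsetP => [[i j]]; rewrite inE => Nij ->; exists i, j.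
split.
- move=> e /mem_edges[i [j [/Nlt ij ->]]]; rewrite cards2.
  by rewrite (_ : (i != j)) // -(inj_eq val_inj) ltn_eqF.
- move=> v; have [s ps ls] := chain_right Nlt v.
  have [x [s' [ps' ls' sub nox]]] := chain_left Nlt ps.
  have ls'' y : ~~ N (last x s') y by rewrite ls'.
  exists (x :: s'); first exact/sub/mem_head.
  (* A one-vertex chain would be coloured true as a first vertex and false as a last one. *)
  apply: chain_wave_component => //; apply/eqP => s'0.
  by have := last_u _ ls''; rewrite s'0 /= first_u.
pose up e := [exists x, [exists y, [&& N x y, e == [set x; y]%SET & u x]]].
have upE i j : N i j -> up [set i; j]%SET = u i.
  move=> Nij; apply/existsP/idP => [[x /existsP[y /and3P[Nxy /eqP]]]|ui].
    by move=> /(set2_lt_inj (Nlt _ _ Nij) (Nlt _ _ Nxy))[-> _].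
  by exists i; apply/existsP; exists j; rewrite Nij eqxx.
pose par (i j : 'I_m) := parabola (u i) (i.+1%:R : R) j.+1%:R.
pose arc e : set (R * R) := [set z | exists i j, [/\ N i j, e = [set i; j]%SET
  & par i j z]]%classic.
have arcE i j : N i j -> arc [set i; j]%SET = par i j.
  move=> Nij; apply/seteqP; split => [z [x [y [Nxy]]]|z pz]; last by exists i, j.
  by move=> /(set2_lt_inj (Nlt _ _ Nij) (Nlt _ _ Nxy))[-> ->].
exists up, arc; split.
- move=> p /wave_component_chain[x [s [-> s0 ps nox nol]]].
  have ls : ~~ u (last x s) by apply: last_u => y; rewrite -edge_ltE.
  apply/(alternating_edges s0 _ ls).
    by apply: sub_path ps => a b; rewrite edge_ltE => /upE ->.
  split; first by apply: first_u => y; rewrite -edge_ltE.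
  by apply: sub_path ps => a b; rewrite edge_ltE => /alt ->; case: (u a).
- move=> i j ij; rewrite mem_edges_of // => Nij; rewrite upE // arcE //.
  by apply: parabola_arc; rewrite ltr_nat.
- move=> e f /mem_edges[i [j [Nij ->]]] /mem_edges[i' [j' [Nij' ->]]] ef z [].
  rewrite !arcE // => zij zij'.
  (* On the same side the intervals are nested or disjoint: one arc cannot end where the other
     starts, since colours alternate along an edge. *)
  have [same|opp] := eqVneq (u i) (u i').
    exfalso; have disj a b a' b' : N a b -> N a' b' -> u a = u a' -> (a < a')%N ->
        par a b z -> par a' b' z -> False.
      move=> Nab Nab' uaa aa'; rewrite /par uaa; apply: parabola_nested.
        by rewrite ltr_nat.
      rewrite !ltr_nat !ltnS; have [a'b|ba'|/val_inj a'b] := ltngtP a' b.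
      + by left; exact: cross Nab Nab' uaa aa' a'b.
      + by right.
      + by have := alt _ _ Nab; rewrite -a'b uaa; case: (u a').
    have [ii'|ii'|/val_inj ii'] := ltngtP i i'.
    + exact: disj Nij Nij' same ii' zij zij'.
    + exact: disj Nij' Nij (esym same) ii' zij' zij.
    + by move: ef; rewrite -ii' in Nij' *; rewrite (Nfun _ _ _ Nij Nij') eqxx.
  (* On opposite sides the arcs meet only on the real line, at a vertex of both edges. *)
  have [[v vij ->] [v' v'ij zE]] : (exists2 v, v \in [set i; j]%SET & z = vertex_point R v) /\
      (exists2 v, v \in [set i'; j']%SET & z = vertex_point R v).
    have endpts (a b c d : 'I_m) : (a < b)%N -> (c < d)%N ->
        parabola true (a.+1%:R : R) b.+1%:R z -> parabola false (c.+1%:R : R) d.+1%:R z ->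
        (exists2 v, v \in [set a; b]%SET & z = @vertex_point R m v) /\
        (exists2 v, v \in [set c; d]%SET & z = @vertex_point R m v).
      move=> ab cd zab zcd.
      have [||z1 z2] := parabola_opposite _ _ zab zcd; rewrite ?ltr_nat //.
      by split; [case: z1 => ->; [exists a|exists b]|case: z2 => ->; [exists c|exists d]];
        rewrite ?set21 ?set22.
    move: zij zij' opp; rewrite /par; case: (u i) => z1; case: (u i') => // z2 _.
      by apply: endpts z1 z2; exact: Nlt.
    by apply/and_comm; apply: endpts z2 z1; exact: Nlt.
  exists v => //; split => //.
  by rewrite (vertex_point_inj zE).
Qed.

Lemma half_plane_arcs_cross (R : realType) (up : bool) (a b c d : R) (A B : set (R * R)) :
  a < b -> b < c -> c < d -> arc_in_half_plane up (a, 0) (c, 0) A ->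
  arc_in_half_plane up (b, 0) (d, 0) B -> exists z, A z /\ B z.
Proof.
move=> ab bc cd [g [[cg _] g0 g1 gup <-]] [h [[ch _] h0 h1 hup <-]].
suff [s [t [s01 t01 gh]]] : exists s t, [/\ 0 <= s <= 1, 0 <= t <= 1 & g s = h t].
  exists (g s); split; first by exists s => //=; rewrite in_itv.
  by exists t => //=; rewrite in_itv.
have inI (t : R) : 0 < t < 1 -> `]0, 1[%classic t by rewrite /= in_itv.
case: up gup hup => gup hup.
  apply: (arcs_cross cg ch g0 g1 h0 h1) => // t /inI t01.
    by apply: gup; exists t.
  by apply: hup; exists t.
(* Reflection in the real line reduces the lower half-plane to the upper one. *)
pose flip (z : R * R) := (z.1, - z.2).
have cont_flip : continuous flip.
  by move=> z; exact: cvg_pair cvg_fst (cvgN cvg_snd).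
have cflip (f : R -> R * R) : {within `[0, 1], continuous f}%classic ->
    {within `[0, 1], continuous (flip \o f)}%classic.
  move=> /subspace_continuousP cf; apply/subspace_continuousP => t It.
  exact: (cvg_comp f flip (cf t It) (cont_flip (f t))).
have flipE x : flip (x, 0) = (x, 0) by rewrite /flip oppr0.
have [||||t /inI t01|t /inI t01|s [t [s01 t01 [e1 /oppr_inj e2]]]] :=
  arcs_cross (cflip g cg) (cflip h ch) _ _ _ _ ab bc cd.
- by rewrite /= g0 flipE.
- by rewrite /= g1 flipE.
- by rewrite /= h0 flipE.
- by rewrite /= h1 flipE.
- by rewrite /= oppr_gt0; apply: gup; exists t.
- by rewrite /= oppr_gt0; apply: hup; exists t.
- by exists s, t; split => //; move: e1 e2; case: (g s) => ? ?; case: (h t) => ? ? /= -> ->.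
Qed.

Lemma plane_graph_coloring (R : realType) m (E : {set {set 'I_m}}) :
  plane_symplectic_wave_graph R E ->
  exists (N : rel 'I_m) (u : pred 'I_m), wave_coloring N u /\ E = edges_of N.
Proof.
move=> [simE comp [up [arc [alt_up arcs disj]]]].
pose N := edge_lt E.
have Nlt i j : N i j -> (i < j)%N by case/andP.
have Nfun i j j' : N i j -> N i j' -> j = j'.
  by move=> Nij Nij'; have [p ip wp] := comp i; exact: (edge_lt_fun wp ip Nij Nij').
have Ninj i i' j : N i j -> N i' j -> i = i'.
  by move=> Nij Ni'j; have [p jp wp] := comp j; exact: (edge_lt_inj wp jp Nij Ni'j).
(* False at a last vertex, as [coloring_last] demands. *)
pose u v := [exists j, N v j && up [set v; j]%SET].
have uE i j : N i j -> u i = up [set i; j]%SET.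
  move=> Nij; apply/existsP/idP => [[j' /andP[Nij']]|upij].
    by rewrite (Nfun _ _ _ Nij Nij').
  by exists j; rewrite Nij.
have no_succ v : (forall y, ~~ N v y) -> ~~ u v.
  by move=> nov; apply/existsPn => y; rewrite (negbTE (nov y)).
have chain v : exists x s, [/\ v \in x :: s, path N x s,
    u x && path (fun a b => u a != u b) x s, forall y, ~~ N y x
    & forall y, ~~ N (last x s) y].
  have [p vp wp] := comp v; have := alt_up p wp.
  have [x [s [pE s0 ps nox nol]]] := wave_component_chain wp.
  rewrite pE in vp *; move=> /(alternating_edges s0 (u := u)) [].
  - by apply: sub_path ps => a b /uE ->.
  - exact: no_succ.
  - by move=> ux pu; exists x, s; split => //; rewrite ux.
exists N, u; split; last by rewrite edges_of_edge_lt.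
split => //.
- move=> i j Nij; have [x [s [ixs ps /andP[_ pu] _ nol]]] := chain i.
  have [il|[_]] := path_succ Nfun ps pu ixs Nij; last by case: (u i); case: (u j).
  by have := nol j; rewrite -il Nij.
- move=> j noj; have [x [s [jxs ps /andP[ux _] _ _]]] := chain j.
  move: jxs; rewrite inE => /predU1P[->//|js].
  case/splitPr: js ps => s1 s2; rewrite cat_path /= => /and3P[_ Nj _].
  by have := noj (last x s1); rewrite Nj.
- move=> i j i' j' Nij Nij' uii ii' i'j; rewrite ltnNge leq_eqVlt; apply/negP.
  move=> /predU1P[/val_inj jj'|jj'].
    by move: ii'; rewrite -jj' in Nij'; rewrite (Ninj _ _ _ Nij Nij') ltnn.
  have [/andP[ij ijE] /andP[ij' ijE']] := (Nij, Nij').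
  have A := arcs i j ij ijE; have B := arcs i' j' ij' ijE'.
  rewrite -(uE _ _ Nij) uii in A; rewrite -(uE _ _ Nij') in B.
  (* Here [i < i' < j < j']: the arcs meet, and the drawing allows this only at a common endpoint,
     which does not exist. *)
  have [|||z zAB] := half_plane_arcs_cross _ _ _ A B; rewrite ?ltr_nat //.
  have neq : [set i; j]%SET != [set i'; j']%SET.
    by apply/eqP => /(set2_lt_inj ij ij')[ii _]; rewrite ii ltnn in ii'.
  have [v [] ] := disj _ _ ijE ijE' neq z zAB.
  by rewrite !inE => /orP[]/eqP-> /orP[]/eqP vE _; move: ii' i'j jj'; rewrite ?vE; lia.
Qed.

(** * Graphs and excursions *)

(* Variations of the numbers a and b of quadrant_excursion. *)
Definition up_step (w : seq (bool * bool)) (i : nat) : int :=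
  if (nth (false, false) w i).1 then 1 else -1.

Definition low_step (w : seq (bool * bool)) (i : nat) : int :=
  let: (u, l) := nth (false, false) w i in if l then if u then -1 else 1 else 0.

Lemma quadrant_excursionP a b w : quadrant_excursion a b w <->
  (forall i, (i <= size w)%N ->
     0 <= a%:Z + height (up_step w) i /\ 0 <= b%:Z + height (low_step w) i) /\
  a%:Z + height (up_step w) (size w) = 0 /\
  b%:Z + height (low_step w) (size w) = 0.
Proof.
elim: w a b => [|[u l] w IH] a b.
  rewrite /= !height0 !addr0; split=> [/andP[/eqP-> /eqP->]|[_ [a0 b0]]]; last lia.
  by split => // i; rewrite leqn0 => /eqP->; rewrite !height0.
have upS i : height (up_step ((u, l) :: w)) i.+1 =
    (if u then 1 else -1) + height (up_step w) i by rewrite height_cons.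
have lowS i : height (low_step ((u, l) :: w)) i.+1 =
    (if l then if u then -1 else 1 else 0) + height (low_step w) i.
  by rewrite height_cons.
have heads (a' b' : nat) : a'%:Z = a%:Z + (if u then 1 else -1) ->
    b'%:Z = b%:Z + (if l then if u then -1 else 1 else 0) ->
    quadrant_excursion a' b' w <->
    (forall i, (i <= size ((u, l) :: w))%N ->
       0 <= a%:Z + height (up_step ((u, l) :: w)) i /\
       0 <= b%:Z + height (low_step ((u, l) :: w)) i) /\
    a%:Z + height (up_step ((u, l) :: w)) (size ((u, l) :: w)) = 0 /\
    b%:Z + height (low_step ((u, l) :: w)) (size ((u, l) :: w)) = 0.
  move=> a'E b'E; rewrite IH /= upS lowS !addrA -a'E -b'E.
  split=> [[pos fin]|[pos fin]]; split => //.
    case=> [_|i isz]; first by rewrite !height0; lia.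
    by rewrite upS lowS !addrA -a'E -b'E; exact: pos.
  by move=> i isz; have := pos i.+1 isz; rewrite upS lowS !addrA -a'E -b'E.
(* The guards [0 < a] and [0 < b] follow from nonnegativity after one step. *)
have drop (c : bool) (P Q : Prop) : (c -> P <-> Q) -> (Q -> c) -> (c /\ P) <-> Q.
  by move=> h1 h2; split=> [[/h1 hc /hc]|q] //; split; [exact: h2|apply/h1; [exact: h2|]].
case: u l upS lowS heads => [] [] upS lowS heads /=.
- rewrite -(rwP andP); apply: drop => [b0|[pos _]]; first by apply: heads; lia.
  by have [_] := pos 1%N isT; rewrite lowS height0; lia.
- by apply: heads; lia.
- rewrite -(rwP andP); apply: drop => [a0|[pos _]]; first by apply: heads; lia.
  by have [+ _] := pos 1%N isT; rewrite upS height0; lia.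
- rewrite -(rwP andP); apply: drop => [a0|[pos _]]; first by apply: heads; lia.
  by have [+ _] := pos 1%N isT; rewrite upS height0; lia.
Qed.

Definition word_matching (m : nat) (w : seq (bool * bool)) : rel 'I_m :=
  fun i j => `[< matched (up_step w) i j \/ matched (low_step w) i j >].

Definition word_color (m : nat) (w : seq (bool * bool)) : pred 'I_m :=
  fun v => (nth (false, false) w v).1.

Section Word.
Variables (m : nat) (w : seq (bool * bool)).
Hypotheses (size_w : size w = m) (exc_w : quadrant_excursion 0 0 w).
Notation N := (@word_matching m w).
Notation u := (@word_color m w).
Let l (v : 'I_m) := (nth (false, false) w v).2.

Let upE (v : 'I_m) : up_step w v = if u v then 1 else -1.
Proof. by []. Qed.

Let lowE (v : 'I_m) : low_step w v = if l v then if u v then -1 else 1 else 0.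
Proof. by rewrite /low_step /l /word_color; case: (nth _ _ _). Qed.

Lemma word_height_ge0 i : (i <= m)%N ->
  0 <= height (up_step w) i /\ 0 <= height (low_step w) i.
Proof.
have /quadrant_excursionP[pos _] := exc_w.
by move=> im; have := pos i; rewrite size_w !add0r; apply.
Qed.

Lemma word_height_end : height (up_step w) m = 0 /\ height (low_step w) m = 0.
Proof.
by have /quadrant_excursionP[_] := exc_w; rewrite size_w !add0r.
Qed.

(** With [u] a vertex opens an upper arc, with [~~ u] and [l] a lower one. Both heights end at 0, so
    every opener finds a partner. *)
Lemma word_succ (v : 'I_m) : [exists j, N v j] = u v || l v.
Proof.
have [hu hl] := word_height_ge0 (ltnW (ltn_ord v)).
have [eu el] := word_height_end.
apply/existsP/orP => [[j /asboolP[[_ + _ _ _]|[_ + _ _ _]]]|].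
- by rewrite upE; case: (u v) => //; left.
- by rewrite lowE; case: (l v) => //; right.
have [uv _|uv [//|lv]] := boolP (u v).
  have [||||j jm vj] := @matched_opener (up_step w) m v.
  - by move=> j; rewrite /up_step; case: ifP.
  - by rewrite eu.
  - exact: ltn_ord.
  - by rewrite upE uv.
  by exists (Ordinal jm); apply/asboolP; left.
have [||||j jm vj] := @matched_opener (low_step w) m v.
- by move=> j; rewrite /low_step; case: (nth _ _ _) => [[] []].
- by rewrite el.
- exact: ltn_ord.
- by rewrite lowE lv (negbTE uv).
by exists (Ordinal jm); apply/asboolP; right.
Qed.

Lemma word_pred (v : 'I_m) : [exists i, N i v] = ~~ u v || l v.
Proof.
have [hu hl] := word_height_ge0 (ltn_ord v).
apply/existsP/orP => [[i /asboolP[[_ _ + _ _]|[_ _ + _ _]]]|].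
- by rewrite upE; case: (u v) => //; left.
- by rewrite lowE; case: (l v) => //; right.
have [uv [//|lv]|uv _] := boolP (u v).
  have [||i iv] := @matched_closer (low_step w) v _ hl.
  - by move=> j; rewrite /low_step; case: (nth _ _ _) => [[] []].
  - by rewrite lowE lv uv.
  have [iv' _ _ _ _] := iv; have im := ltn_trans iv' (ltn_ord v).
  by exists (Ordinal im); apply/asboolP; right.
have [||i iv] := @matched_closer (up_step w) v _ hu.
- by move=> j; rewrite /up_step; case: ifP.
- by rewrite upE (negbTE uv).
have [iv' _ _ _ _] := iv; have im := ltn_trans iv' (ltn_ord v).
by exists (Ordinal im); apply/asboolP; left.
Qed.

(** Upper arcs run from [u] to [~~ u] and lower arcs from [~~ u] to [u], so the colour of the start
    determines the side. *)
Lemma word_matching_half (i j : 'I_m) : N i j ->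
  u j = ~~ u i /\ if u i then matched (up_step w) i j else matched (low_step w) i j.
Proof.
move=> /asboolP[] ij; have [_ + + _ _] := ij; rewrite ?upE ?lowE.
  by case: (u i) => //; case: (u j).
by case: (l i); case: (u i) => //; case: (l j); case: (u j).
Qed.

Lemma word_wave_coloring : wave_coloring N u.
Proof.
split.
- by move=> i j /asboolP[[]|[]].
- move=> i j j' /word_matching_half[_ ij] /word_matching_half[_ ij'].
  by apply: val_inj; move: ij ij'; case: (u i); exact: matched_fun.
- move=> i i' j /word_matching_half[uj ij] /word_matching_half[uj' ij'].
  have uii : u i = u i' by apply: negb_inj; rewrite -uj -uj'.
  by apply: val_inj; move: ij ij'; rewrite -uii; case: (u i); exact: matched_inj.
- by move=> i j /word_matching_half[].
- move=> j noj; have : ~~ [exists i, N i j] by apply/existsPn.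
  by rewrite word_pred negb_or negbK => /andP[].
- move=> i noi; have : ~~ [exists j, N i j] by apply/existsPn.
  by rewrite word_succ negb_or => /andP[].
- move=> i j i' j' /word_matching_half[_ ij] /word_matching_half[_ ij'] uii.
  by move: ij ij'; rewrite -uii; case: (u i); exact: matched_noncrossing.
Qed.

Lemma word_middle (v : 'I_m) : l v = [exists i, N i v] && [exists j, N v j].
Proof. by rewrite word_pred word_succ; case: (u v); case: (l v). Qed.
End Word.

(** Colours are forced from left to right: true at a first vertex, then alternating. *)
Lemma wave_coloring_unique m (N : rel 'I_m) (u u' : pred 'I_m) :
  wave_coloring N u -> wave_coloring N u' -> u =1 u'.
Proof.
move=> c c' v; have [n] := ubnP v; elim: n v => // n IH v vn.
have [/existsP[i Niv]|/existsPn nov] := boolP [exists i, N i v].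
  rewrite (coloring_alt c Niv) (coloring_alt c' Niv) IH //.
  by have := coloring_lt c Niv; lia.
by rewrite (coloring_first c nov) (coloring_first c' nov).
Qed.

Lemma edges_of_inj m (N N' : rel 'I_m) : (forall i j, N i j -> (i < j)%N) ->
  (forall i j, N' i j -> (i < j)%N) -> edges_of N = edges_of N' -> N =2 N'.
Proof.
move=> Nlt Nlt' eqE i j; have [ij|ij] := boolP (i < j)%N.
  by rewrite -(mem_edges_of Nlt ij) eqE mem_edges_of.
by apply/idP/idP => [/Nlt|/Nlt']; rewrite (negbTE ij).
Qed.

(** The edges determine the relation, the relation determines the colours, and the second bit marks
    the vertices with neighbours on both sides. *)
Lemma word_edges_inj m (w w' : m.-tuple (bool * bool)) :
  quadrant_excursion 0 0 w -> quadrant_excursion 0 0 w' ->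
  edges_of (@word_matching m w) = edges_of (@word_matching m w') -> w = w'.
Proof.
move=> ew ew'; have c := word_wave_coloring (size_tuple w) ew.
have c' := word_wave_coloring (size_tuple w') ew'.
move=> /(edges_of_inj (coloring_lt c) (coloring_lt c')) NN'.
have cc' : wave_coloring (@word_matching m w) (@word_color m w').
  by have -> : @word_matching m w = @word_matching m w' by apply/funext => i; apply/funext.
have uE := wave_coloring_unique c cc'.
apply: eq_from_tnth => v; rewrite !(tnth_nth (false, false)).
rewrite [LHS]surjective_pairing [RHS]surjective_pairing; congr pair; first exact: uE.
rewrite (word_middle (size_tuple w) ew) (word_middle (size_tuple w') ew').
by congr (_ && _); apply: eq_existsb => x; rewrite NN'.
Qed.

Lemma sum_eq1 m (P : pred 'I_m) (x : 'I_m) : P x -> (forall y, P y -> y = x) ->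
  \sum_y (P y)%:Z = 1.
Proof.
move=> Px uniq_x; rewrite (bigD1 x) //= Px big1 ?addr0 // => y yx.
by case: (boolP (P y)) => // /uniq_x yE; rewrite yE eqxx in yx.
Qed.

Lemma sum_eq0 m (P : pred 'I_m) : (forall y, ~~ P y) -> \sum_y (P y)%:Z = 0.
Proof. by move=> noP; rewrite big1 // => y _; rewrite (negbTE (noP y)). Qed.

Lemma wave_coloring_word m (N : rel 'I_m) (u : pred 'I_m) : wave_coloring N u ->
  exists2 w : m.-tuple (bool * bool), quadrant_excursion 0 0 w & N =2 @word_matching m w.
Proof.
move=> c; have [Nlt Nfun Ninj alt first_u last_u cross] := c.
pose l v := [exists i, N i v] && [exists j, N v j].
pose w := [tuple (u v, l v) | v < m].
have nth_w (v : 'I_m) : nth (false, false) w v = (u v, l v).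
  by rewrite -tnth_nth tnth_mktuple.
pose U : rel 'I_m := fun i j => N i j && u i.
pose L : rel 'I_m := fun i j => N i j && ~~ u i.
have succ v : u v || l v -> exists j, N v j.
  move=> /orP[uv|/andP[_ /existsP//]]; apply/existsP; apply: contraLR uv => /existsPn.
  exact: last_u.
have pred v : ~~ u v || l v -> exists i, N i v.
  move=> /orP[uv|/andP[/existsP//]]; apply/existsP; apply: contraNT uv => /existsPn.
  exact: first_u.
have noUpred v : u v -> forall i, ~~ U i v.
  by move=> uv i; apply/andP => -[/alt]; rewrite uv => /esym /negbTE ->.
have noUsucc v : ~~ u v -> forall j, ~~ U v j.
  by move=> uv j; rewrite /U (negbTE uv) andbF.
have noLpred v : ~~ u v || ~~ l v -> forall i, ~~ L i v.
  move=> uv i; apply/andP => -[Niv ui]; have := alt _ _ Niv; rewrite ui => uv'.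
  move: uv; rewrite uv' /= => /negP; apply; apply/andP; split; apply/existsP; first by exists i.
  by apply: contrapT => /forallNP nov; have := last_u v (fun j => introN idP (nov j)); rewrite uv'.
have noLsucc v : u v || ~~ l v -> forall j, ~~ L v j.
  move=> uv j; apply/andP => -[Nvj uv']; move: uv; rewrite (negbTE uv') /=.
  move=> /negP; apply; apply/andP; split; apply/existsP; last by exists j.
  by apply: pred; rewrite uv'.
(* Every vertex is an endpoint of exactly one upper arc, and its colour tells which end. *)
have upE (v : 'I_m) : up_step w v = net U v.
  rewrite /up_step nth_w /net big_split sumrN /=.
  case: ifPn => uv.
    have [j Nvj] := succ v (introT orP (or_introl uv)).
    rewrite (sum_eq1 (x := j)) ?(sum_eq0 (noUpred _ uv)) ?subr0 //.
      by rewrite /U Nvj.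
    by move=> y /andP[/(Nfun _ _ _ Nvj)].
  have [i Niv] := pred v (introT orP (or_introl uv)).
  rewrite (sum_eq0 (noUsucc _ uv)) (sum_eq1 (x := i)) ?sub0r //.
    by rewrite /U Niv; have := alt _ _ Niv; move: uv; case: (u v); case: (u i).
  by move=> y /andP[/Ninj yi _]; exact: yi.
have lowE (v : 'I_m) : low_step w v = net L v.
  rewrite /low_step nth_w /net big_split sumrN /=.
  case: ifPn => lv; last first.
    by rewrite (sum_eq0 (noLsucc _ _)) ?(sum_eq0 (noLpred _ _)) ?lv ?orbT.
  case: ifPn => uv.
    have [i Niv] := pred v (introT orP (or_intror lv)).
    rewrite (sum_eq0 (noLsucc _ _)) ?uv // (sum_eq1 (x := i)) ?sub0r //.
      by rewrite /L Niv; have := alt _ _ Niv; rewrite uv => /esym.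
    by move=> y /andP[/Ninj yi _]; exact: yi.
  have [j Nvj] := succ v (introT orP (or_intror lv)).
  rewrite (sum_eq1 (x := j)) ?(sum_eq0 (noLpred _ _)) ?uv ?subr0 //.
    by rewrite /L Nvj.
  by move=> y /andP[/(Nfun _ _ _ Nvj)].
have Ult v x : U v x -> (v < x)%N by case/andP => /Nlt.
have Llt v x : L v x -> (v < x)%N by case/andP => /Nlt.
have exc : quadrant_excursion 0 0 w.
  apply/quadrant_excursionP; rewrite size_tuple (height_net_end upE) (height_net_end lowE).
  split => // i im; rewrite !add0r; split; first exact: height_net_ge0 upE Ult im.
  exact: height_net_ge0 lowE Llt im.
(* One inclusion is [matched_net], applied to each side separately. *)
have sub i j : N i j -> word_matching w i j.
  move=> Nij; apply/asboolP; have uj := alt _ _ Nij.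
  have [ui|ui] := boolP (u i); [left|right].
    apply: (matched_net upE) (_ : U i j); last by rewrite /U Nij.
    - move=> a b /andP[Nab ua]; rewrite /up_step !nth_w /= ua (alt _ _ Nab) ua.
      by split => //; exact: Nlt.
    - by move=> a b b' /andP[Nab _] /andP[Nab' _]; exact: Nfun Nab Nab'.
    - move=> a b a' b' /andP[Nab ua] /andP[Nab' ua']; apply: cross Nab Nab' _.
      by rewrite ua ua'.
  apply: (matched_net lowE) (_ : L i j); last by rewrite /L Nij.
  - move=> a b Lab; have [Nab ua] := andP Lab; rewrite /low_step !nth_w /=.
    have -> : l a by apply: contraTT Lab => la; apply: noLsucc; rewrite la orbT.
    have -> : l b by apply: contraTT Lab => lb; apply: noLpred; rewrite lb orbT.
    by rewrite (negbTE ua) (alt _ _ Nab) ua; split => //; exact: Nlt.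
  - by move=> a b b' /andP[Nab _] /andP[Nab' _]; exact: Nfun Nab Nab'.
  - move=> a b a' b' /andP[Nab ua] /andP[Nab' ua']; apply: cross Nab Nab' _.
    by rewrite (negbTE ua) (negbTE ua').
(* For the converse, a vertex with a successor in the word matching also has one in [N], and by
   [sub] and uniqueness the two agree. *)
exists w => // i j; apply/idP/idP => [/sub//|wij].
have cw := word_wave_coloring (size_tuple w) exc.
have : [exists j, word_matching w i j] by apply/existsP; exists j.
rewrite (word_succ (size_tuple w) exc) /word_color nth_w => /succ[j' Nij'].
by rewrite (coloring_fun cw wij (sub _ _ Nij')).
Qed.

Lemma card_plane_symplectic_wave_graphs (R : realType) (m : nat) :
  #|plane_symplectic_wave_graphs R m| =
  #|[set w : m.-tuple _ | quadrant_excursion 0 0 w]%SET|.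
Proof.
rewrite -[RHS](card_in_imset (f := fun w : m.-tuple _ => edges_of (@word_matching m w))).
  apply: eq_card => E; rewrite inE; apply/asboolP/imsetP => [/plane_graph_coloring|].
    move=> [N [u [/wave_coloring_word[w ew NE] ->]]]; exists w; first by rewrite inE.
    by congr edges_of; apply/funext => i; apply/funext => j; exact: NE.
  move=> [w]; rewrite inE => ew ->; apply: wave_coloring_graph.
  exact: word_wave_coloring (size_tuple w) ew.
by move=> w w'; rewrite !inE; exact: word_edges_inj.
Qed.

Theorem theorem30 (R : realType) (k : nat) (hk : (1 <= k)%N) :
  #|plane_symplectic_wave_graphs R (2 * k)|%:R =
  ((2 * k)`!)%:R * ((2 * k + 2)`!)%:R * 6
    / ((k`!)%:R * ((k + 1)`!)%:R * ((k + 2)`!)%:R * ((k + 3)`!)%:R) :> rat.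
Proof. by rewrite card_plane_symplectic_wave_graphs card_excursions. Qed.
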